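(* Let $G=\mathrm{Sz}(q)$ be the Suzuki group with $q=2^{2n+1}$, $n\geq 1$, and let $\mathcal{C}$ be its conjugacy class of involutions. Then $\mathcal{K}(G,\mathcal{C})$ equals the commuting graph on $\mathcal{C}$, and $K_{\mathcal{C}}$ is reducible and non-degenerate.
   Context: For a finite group $G$ and a subset $\mathcal{C}\subseteq G\setminus\{1\}$ closed under conjugation, the Killing form $K_{\mathcal{C}}$ is the bilinear form on the complex vector space with basis $\mathcal{C}$ given on basis elements by $K_{\mathcal{C}}(a,b)=|C_G(ab)\cap\mathcal{C}|$; it is non-degenerate if the matrix $(K_{\mathcal{C}}(a,b))_{a,b\in\mathcal{C}}$ is invertible. $\mathcal{K}(G,\mathcal{C})$ is the graph with vertex set $\mathcal{C}$ in which distinct $a,b$ are adjacent iff $C_G(ab)\cap\mathcal{C}\neq\emptyset$. $K_{\mathcal{C}}$ is irreducible if $\mathcal{K}(G,\mathcal{C})$ is connected and reducible otherwise. The commuting graph on $\mathcal{C}$ has vertex set $\mathcal{C}$, with distinct $a,b$ adjacent iff $ab=ba$. *)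

(* Defs.v *)
From HB Require Import structures.
From mathcomp Require Import all_boot all_order all_algebra all_fingroup all_field.
Set Implicit Arguments. Unset Strict Implicit. Unset Printing Implicit Defensive.
Import GRing.Theory.
Local Open Scope ring_scope.

Section KillingForm.
Variable gT : finGroupType.

Definition killing_mx (G C : {set gT}) : 'M[algC]_#|C| :=
  \matrix_(i < #|C|, j < #|C|)
     (#|('C_G[enum_val i * enum_val j] :&: C)%g|)%:R.

Definition killing_nondegenerate (G C : {set gT}) : bool :=
  killing_mx G C \in unitmx.

Definition killing_adj (G C : {set gT}) : rel gT :=
  fun a b => [&& a \in C, b \in C, a != b &
                 ('C_G[a * b] :&: C)%g != set0].

Definition commuting_adj (C : {set gT}) : rel gT :=
  fun a b => [&& a \in C, b \in C, a != b & (a * b == b * a)%g].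

Definition killing_irreducible (G C : {set gT}) : Prop :=
  forall a b, a \in C -> b \in C -> connect (killing_adj G C) a b.

Definition killing_reducible (G C : {set gT}) : Prop :=
  ~ killing_irreducible G C.
End KillingForm.

(** * The Suzuki group Sz(q), q = 2^(2n+1), realised as the stabiliser in
    SL_4(F) (|F| = q) of the Tits ovoid of PG(3,q).  Since gcd(4,q-1)=1,
    SL_4(q) = PSL_4(q) = PGL_4(q), and the stabiliser of the Tits ovoid in
    PGL_4(q) is Sz(q). Matrices act on row vectors: v |-> v *m A. *)
Section Suzuki.
Variables (F : finFieldType) (n : nat).

(** sigma : x |-> x^(2^(n+1)), the field automorphism with sigma^2 = Frobenius. *)
Definition sz_sigma (x : F) : F := x ^+ (2 ^ n.+1).

Definition row4 (a b c d : F) : 'rV[F]_4 :=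
  \row_(i < 4) nth 0 [:: a; b; c; d] i.

(** Normalised representatives of the points of the Tits ovoid
    { (1,x,y, xy + x^(sigma+2) + y^sigma) } ∪ { (0,0,0,1) }. *)
Definition tits_rep (v : 'rV[F]_4) : bool :=
  (v == row4 0 0 0 1) ||
  [exists x : F, exists y : F,
     v == row4 1 x y (x * y + sz_sigma x * x ^+ 2 + sz_sigma y)].

Definition on_tits_ovoid (v : 'rV[F]_4) : bool :=
  [exists c : F, (c != 0) && tits_rep (c *: v)].

Definition Suzuki : {set {'GL_4[F]}} :=
  [set A : {'GL_4[F]} | (\det (GLval A) == 1) &&
     [forall v : 'rV[F]_4, on_tits_ovoid v ==> on_tits_ovoid (v *m GLval A)]].
End Suzuki.

(* Main.v *)
(* An involution of Sz(q) fixes exactly one point of the Tits ovoid (which has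
   q^2 + 1 points, an odd number), two involutions commute iff they have the same fixed
   point, and only the identity fixes three points.  If an involution c fixing
   p centralises a product a b of distinct involutions, then a b fixes p; were
   p moved by a, then a b would fix the three points p, p a and p a c.  Hence
   c, a and b all fix p and commute.  The Killing graph is therefore the commuting
   graph, whose edges preserve the fixed point, and the Killing matrix is
   E E^T + D, with E the 0-1 matrix of the commuting relation and D a positive
   diagonal matrix.  The facts about Sz(q) follow from the shape of the
   stabiliser of two ovoid points, which is read off by comparing coefficients of
   polynomials of degree less than q. *)
Require Import Defs.
From mathcomp Require Import all_boot all_order all_algebra all_fingroup all_field.
From mathcomp Require Import all_solvable ring zify.

Set Implicit Arguments. Unset Strict Implicit. Unset Printing Implicit Defensive.

(** * Real Gram matrices with a positive diagonal added *)

Section GramMatrix.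
Import Order.TTheory GRing.Theory Num.Theory.
Local Open Scope ring_scope.

(** For u in the left kernel, multiplying by the conjugate transpose of u gives 0 as the squared
    norm of [u *m E] plus the sum of d_j |u_j|^2. Both parts are nonnegative, so every u_j vanishes.
    Reality of E makes [E^T] its conjugate transpose. *)
Lemma gram_add_diag_unitmx m k (E : 'M[algC]_(m, k)) (d : 'rV[algC]_m) :
  (forall i j, (E i j)^* = E i j) -> (forall i, 0 < d 0 i) ->
  E *m E^T + diag_mx d \in unitmx.
Proof.
move=> Ereal d0; rewrite -row_free_unit -kermx_eq0.
set K := E *m E^T + diag_mx d; apply/eqP/row_matrixP=> i; rewrite row0.
set u := row i (kermx K); have uK : u *m K = 0 by rewrite -row_mul mulmx_ker row0.
pose v := (map_mx Num.conj u)^T; pose w := u *m E.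
have sum0 : (\sum_l `|w 0 l| ^+ 2) + (\sum_j d 0 j * `|u 0 j| ^+ 2) = 0.
  have : (u *m K *m v) 0 0 = 0 by rewrite uK mul0mx mxE.
  rewrite mulmxDr mulmxDl mxE => e0; rewrite -[RHS]e0; congr (_ + _).
    rewrite mulmxA -/w -mulmxA [RHS]mxE; apply: eq_bigr => l _; rewrite normCK; congr (_ * _).
    rewrite !mxE rmorph_sum; apply: eq_bigr => j _.
    by rewrite !mxE rmorphM /= Ereal mulrC.
  rewrite mul_mx_diag [RHS]mxE; apply: eq_bigr => j _.
  by rewrite !mxE normCK mulrCA mulrA.
have w_ge0 : 0 <= \sum_l `|w 0 l| ^+ 2 by apply: sumr_ge0 => l _; rewrite exprn_ge0.
have du_ge0 j : true -> 0 <= d 0 j * `|u 0 j| ^+ 2 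
  by move=> _; rewrite mulr_ge0 ?exprn_ge0 // ltW.
have du_sum := sumr_ge0 (index_enum _) (fun j => du_ge0 j).
move/eqP: sum0; rewrite paddr_eq0 // => /andP[_]; rewrite psumr_eq0 // => /allP u0.
apply/rowP=> j; have := u0 j (mem_index_enum j); rewrite mulf_eq0 (gt_eqF (d0 j)) /=.
by rewrite sqrf_eq0 normr_eq0 => /eqP ->; rewrite mxE.
Qed.

End GramMatrix.

(** * The Killing form on a set of involutions *)

Section Involutions.
Import Order.TTheory GRing.Theory Num.Theory.
Variables (gT : finGroupType) (G C : {set gT}).
Hypotheses (sCG : C \subset G) (C_inv : forall a, a \in C -> (a * a = 1)%g).
Hypothesis C_cent : forall a b c, a \in C -> b \in C -> c \in C -> a != b ->
  commute c (a * b) -> [/\ commute a b, commute c a & commute c b].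

(** If a and b commute, then a itself centralises their product; [C_cent] gives the converse. *)
Lemma killing_adj_commuting a b : killing_adj G C a b = commuting_adj C a b.
Proof.
rewrite /killing_adj /commuting_adj; case aC: (a \in C) => //; case bC: (b \in C) => //=.
case: eqVneq => //= ab; apply/set0Pn/eqP => [[c]|abC].
  rewrite !in_setI => /andP[/andP[_ /cent1P cab] cC].
  by have [] := C_cent aC bC cC ab cab.
exists a; rewrite !in_setI aC (subsetP sCG) //= andbT; apply/cent1P.
by rewrite /commute -mulgA -abC mulgA.
Qed.

Hypothesis C_noncentral : forall a, a \in C -> exists2 c, c \in C & ~ commute c a.

(* The centraliser counts form the Gram matrix of the rows of the commuting
   relation, and only the diagonal exceeds it. *)
Lemma killing_nondegenerate_involutions : killing_nondegenerate G C.
Proof.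
pose com (c a : gT) := c \in 'C[a]%g.
have comP c a : reflect (commute c a) (com c a) by apply: cent1P.
pose E : 'M[algC]_#|C| := (\matrix_(i, l) (com (enum_val l) (enum_val i))%:R)%R.
pose k a := #|[set c in C | com c a]|.
pose d : 'rV[algC]_#|C| := (\row_i (#|C| - k (enum_val i))%:R)%R.
have k_lt a : a \in C -> k a < #|C|.
  move=> aC; have [c cC ca] := C_noncentral aC; apply: proper_card; apply/properP; split.
    by apply/subsetP=> x; rewrite inE => /andP[].
  by exists c => //; rewrite inE cC; apply/comP.
have sumC (P : pred gT) : (\sum_(l < #|C|) (P (enum_val l))%:R = #|[set c in C | P c]|%:R :> algC)%R.
  rewrite -(big_enum_val (fun c : gT => (P c)%:R)%R) -sum1_card natr_sum /=.
  rewrite [RHS](eq_bigl (fun c => (c \in C) && P c)); last by move=> c; rewrite inE.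
  by rewrite big_mkcondr; apply: eq_bigr => c _; case: (P c).
rewrite /killing_nondegenerate (_ : killing_mx G C = E *m E^T + diag_mx d)%R; last first.
  apply/matrixP=> i j; rewrite !mxE; set a := enum_val i; set b := enum_val j.
  have aC : a \in C by apply: enum_valP.
  have bC : b \in C by apply: enum_valP.
  rewrite (eq_bigr (fun l => (com (enum_val l) a && com (enum_val l) b)%:R)%R); last first.
    by move=> l _; rewrite !mxE -natrM mulnb.
  rewrite (sumC (fun c => com c a && com c b)).
  have [ij|ij] := eqVneq i j.
    (* On the diagonal a * a = 1 is centralised by all of C, while the Gram entry is only [k a]; [d]
       makes up the difference. *)
    rewrite mulr1n -/a -natrD; congr (_%:R)%R; rewrite /b -ij -/a C_inv //.
    rewrite (_ : [set c in C | _] = [set c in C | com c a]); last first.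
      by apply/setP=> c; rewrite !inE andbb.
    rewrite -/(k a) subnKC; last exact/ltnW/k_lt.
    by congr #|pred_of_set _|; apply/setP=> c; rewrite !in_setI; apply/andb_idl => cC;
      rewrite (subsetP sCG) //=; apply/cent1P; apply: commute1.
  have ab : a != b by rewrite (inj_eq enum_val_inj).
  rewrite mulr0n addr0; congr (_%:R)%R; congr #|pred_of_set _|; apply/setP=> c.
  rewrite !in_setI [RHS]inE andbC; case cC: (c \in C) => //=; rewrite (subsetP sCG) //=.
  apply/cent1P/andP=> [cab|[/comP ca /comP cb]]; last exact: commuteM.
  by have [_ ca cb] := C_cent aC bC cC ab cab; split; apply/comP.
apply: gram_add_diag_unitmx => [i j|i]; rewrite mxE; first by rewrite rmorph_nat.
by rewrite ltr0n subn_gt0 k_lt ?enum_valP.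
Qed.

End Involutions.

(** * Matrices and row vectors in dimension four *)

Section TitsOvoid.
Import GRing.Theory.
Local Open Scope ring_scope.
Variables (F : finFieldType) (n : nat).
Hypotheses (n_gt0 : (0 < n)%N) (cardF : #|F| = (2 ^ (2 * n).+1)%N).

Local Notation sigma := (@sz_sigma F n).
(* Stating everything over this single [finGroupType] avoids very slow conversions
   between the group structures inferred for products and those for finite groups. *)
Definition GL4 : finGroupType := {'GL_4[F]}.
Definition Sz : {set GL4} := Suzuki F n.
Local Notation G := Sz.

Lemma GLval_mul (A B : GL4) : GLval (A * B)%g = GLval A *m GLval B.
Proof. exact: GL_MxE. Qed.

Lemma GLval_one : GLval (1%g : GL4) = 1%:M.
Proof. by []. Qed.

Lemma pchar2 : 2%N \in [pchar F].
Proof. exact: card_finPcharP cardF isT. Qed.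

Lemma vanishing_poly_eq0 (p : {poly F}) :
  (size p <= #|F|)%N -> (forall x, p.[x] = 0) -> p = 0.
Proof.
move=> szp p0; apply: (@roots_geq_poly_eq0 _ p (enum F)).
- by apply/allP => x _; apply/rootP.
- exact: enum_uniq.
- by rewrite -cardE.
Qed.

Lemma row4E a b c d (i : 'I_4) : row4 a b c d 0 i = nth 0 [:: a; b; c; d] i :> F.
Proof. by rewrite mxE. Qed.

Lemma row4P a b c d a' b' c' d' :
  row4 a b c d = row4 a' b' c' d' :> 'rV[F]_4 -> [/\ a = a', b = b', c = c' & d = d'].
Proof.
move=> /rowP e; split.
- by have := e ord0; rewrite !mxE.
- by have := e (inord 1); rewrite !mxE !inordK.
- by have := e (inord 2); rewrite !mxE !inordK.
- by have := e (inord 3); rewrite !mxE !inordK.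
Qed.

Lemma row4_eta (v : 'rV[F]_4) : exists a b c d, v = row4 a b c d.
Proof.
exists (v 0 (inord 0)), (v 0 (inord 1)), (v 0 (inord 2)), (v 0 (inord 3)).
apply/rowP=> i; rewrite mxE; case: i => [[|[|[|[|i]]]] ilt] //=;
  by congr (v _ _); apply/val_inj; rewrite /= inordK.
Qed.

Lemma row4Z k a b c d : k *: row4 a b c d = row4 (k * a) (k * b) (k * c) (k * d) :> 'rV[F]_4.
Proof. by apply/rowP=> i; rewrite !mxE; case: i => [[|[|[|[|i]]]] ilt]. Qed.

Lemma row4D a b c d a' b' c' d' :
  row4 a b c d + row4 a' b' c' d' = row4 (a + a') (b + b') (c + c') (d + d') :> 'rV[F]_4.
Proof. by apply/rowP=> i; rewrite !mxE; case: i => [[|[|[|[|i]]]] ilt]. Qed.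

Lemma row4_basis a b c d : row4 a b c d =
  a *: row4 1 0 0 0 + b *: row4 0 1 0 0 + c *: row4 0 0 1 0 + d *: row4 0 0 0 1 :> 'rV[F]_4.
Proof. by rewrite !row4Z !row4D !(mulr0, mulr1, addr0, add0r). Qed.

Lemma mx4_eq (A B : 'M[F]_4) :
  row4 1 0 0 0 *m A = row4 1 0 0 0 *m B -> row4 0 1 0 0 *m A = row4 0 1 0 0 *m B ->
  row4 0 0 1 0 *m A = row4 0 0 1 0 *m B -> row4 0 0 0 1 *m A = row4 0 0 0 1 *m B ->
  A = B.
Proof.
move=> e0 e1 e2 e3; apply/row_matrixP=> i; rewrite !rowE.
have [a [b [c [d ->]]]] := row4_eta (delta_mx 0 i).
by rewrite row4_basis !mulmxDl -!scalemxAl e0 e1 e2 e3.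
Qed.

Definition mx4 (r0 r1 r2 r3 : 'rV[F]_4) : 'M[F]_4 :=
  \matrix_(i < 4) nth 0 [:: r0; r1; r2; r3] i.

Lemma row4_mx4 a b c d r0 r1 r2 r3 :
  row4 a b c d *m mx4 r0 r1 r2 r3 = a *: r0 + b *: r1 + c *: r2 + d *: r3.
Proof.
rewrite mulmx_sum_row !big_ord_recl big_ord0 addr0 !addrA.
by rewrite !rowK !row4E.
Qed.


(** * Characteristic two and the automorphism sigma *)

Lemma addxx (x : F) : x + x = 0.
Proof. exact: addrr_pchar2 pchar2 x. Qed.

Lemma sqr_eq1 (x : F) : x ^+ 2 = 1 -> x = 1.
Proof.
move/eqP; rewrite sqrf_eq1 (oppr_pchar2 pchar2) orbb => /eqP //.
Qed.

Lemma sigmaM x y : sigma (x * y) = sigma x * sigma y.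
Proof. exact: exprMn. Qed.

Lemma sigmaD x y : sigma (x + y) = sigma x + sigma y.
Proof.
apply: exprDn_pchar; rewrite pnatX; apply/orP; left.
by rewrite pnatE // pchar2.
Qed.

Lemma sigma0 : sigma 0 = 0.
Proof. by rewrite /sz_sigma expr0n expn_eq0. Qed.

Lemma sigma1 : sigma 1 = 1.
Proof. exact: expr1n. Qed.

Lemma sigmaX x k : sigma (x ^+ k) = sigma x ^+ k.
Proof. by rewrite /sz_sigma exprAC. Qed.

(** The exponent of the composite is 2^(2n+2) = 2q, and x^q = x. *)
Lemma sigma_sigma x : sigma (sigma x) = x ^+ 2.
Proof.
rewrite /sz_sigma -exprM -expnD.
have -> : (n.+1 + n.+1 = (2 * n).+1 + 1)%N by lia.
by rewrite expnD -cardF mulnC exprM expf_card.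
Qed.

Lemma sigmaV x : sigma x^-1 = (sigma x)^-1.
Proof. by rewrite /sz_sigma exprVn. Qed.

Lemma sigma_eq0 x : (sigma x == 0) = (x == 0).
Proof. by rewrite /sz_sigma expf_eq0 expn_gt0. Qed.

(** * The points of the Tits ovoid and the action on them *)

Definition tits (x y : F) : F := x * y + sigma x * x ^+ 2 + sigma y.

Local Notation point := (option (F * F)).

Definition ovoid_vec (p : point) : 'rV[F]_4 :=
  if p is Some (x, y) then row4 1 x y (tits x y) else row4 0 0 0 1.

(** Meaningful only on nonzero multiples of ovoid vectors, among which a zero first coordinate
    characterises the point at infinity [None]. *)
Definition ovoid_point (v : 'rV[F]_4) : point :=
  if v 0 0 == 0 then None
  else Some (v 0 (inord 1) / v 0 0, v 0 (inord 2) / v 0 0).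

Lemma row4_0 a b c d : row4 a b c d 0 0 = a :> F. Proof. by rewrite row4E. Qed.
Lemma row4_1 a b c d : row4 a b c d 0 (inord 1) = b :> F.
Proof. by rewrite row4E inordK. Qed.
Lemma row4_2 a b c d : row4 a b c d 0 (inord 2) = c :> F.
Proof. by rewrite row4E inordK. Qed.

Lemma ovoid_pointZ c p : c != 0 -> ovoid_point (c *: ovoid_vec p) = p.
Proof.
move=> c0; case: p => [[x y]|] /=; rewrite /ovoid_point row4Z row4_0.
  by rewrite mulr1 (negPf c0) row4_1 row4_2 ![c * _]mulrC !mulfK.
by rewrite mulr0 eqxx.
Qed.

Lemma tits_repP v : reflect (exists p, v = ovoid_vec p) (tits_rep n v).
Proof.
apply: (iffP orP) => [[/eqP->|/existsP[x /existsP[y /eqP->]]]|[[[x y]|] ->]].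
- by exists None.
- by exists (Some (x, y)).
- by right; apply/existsP; exists x; apply/existsP; exists y.
- by left.
Qed.

Lemma on_tits_ovoidP v :
  reflect (exists c p, c != 0 /\ v = c *: ovoid_vec p) (on_tits_ovoid n v).
Proof.
apply: (iffP existsP) => [[c /andP[c0 /tits_repP[p vE]]]|[c [p [c0 ->]]]].
  by exists c^-1, p; rewrite invr_eq0 -vE scalerA mulVf ?scale1r.
by exists c^-1; rewrite invr_eq0 c0 scalerA mulVf // scale1r; apply/tits_repP; exists p.
Qed.

Lemma SuzukiP (A : GL4) :
  reflect (\det (GLval A) = 1 /\
           forall p, exists c r, c != 0 /\ ovoid_vec p *m GLval A = c *: ovoid_vec r)
          (A \in G).
Proof.
rewrite inE; apply: (iffP andP) => [[/eqP dA /forallP oA]|[-> oA]]; split=> //.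
  move=> p; apply/on_tits_ovoidP; apply: (implyP (oA _)); apply/on_tits_ovoidP.
  by exists 1, p; rewrite oner_neq0 scale1r.
apply/forallP=> v; apply/implyP=> /on_tits_ovoidP[c [p [c0 ->]]].
have [d [r [d0 e]]] := oA p; apply/on_tits_ovoidP; exists (c * d), r.
by rewrite mulf_neq0 // -scalemxAl e scalerA.
Qed.

Lemma Suzuki1 : 1%g \in G.
Proof.
by apply/SuzukiP; rewrite GLval_one det1; split=> // p; exists 1, p; rewrite oner_neq0 mulmx1 scale1r.
Qed.

Lemma SuzukiM A B : A \in G -> B \in G -> (A * B)%g \in G.
Proof.
move=> /SuzukiP[dA oA] /SuzukiP[dB oB]; apply/SuzukiP.
split=> [|p]; first by rewrite GLval_mul det_mulmx dA dB mulr1.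
have [c [r [c0 e]]] := oA p; have [d [s [d0 e']]] := oB r.
by exists (c * d), s; rewrite mulf_neq0 // GLval_mul mulmxA e -scalemxAl e' scalerA.
Qed.

Lemma Suzuki_group_set : group_set G.
Proof. by apply/group_setP; split; [exact: Suzuki1 | exact: SuzukiM]. Qed.

Lemma SuzukiV A : A \in G -> A^-1%g \in G.
Proof. exact: (@groupVr _ (Group Suzuki_group_set)). Qed.

Lemma SuzukiJ A B : A \in G -> B \in G -> (A ^ B)%g \in G.
Proof. by move=> GA GB; rewrite !SuzukiM // SuzukiV. Qed.

(** Total on [GL4] for convenience; it is an action only on the Suzuki group, whose elements keep
    the ovoid. *)
Definition act (p : point) (A : GL4) : point := ovoid_point (ovoid_vec p *m GLval A).

Lemma act_eq p (A : GL4) c r : c != 0 -> ovoid_vec p *m GLval A = c *: ovoid_vec r -> act p A = r.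
Proof. by move=> c0 e; rewrite /act e ovoid_pointZ. Qed.

Lemma act_vec p (A : GL4) : A \in G -> exists2 c, c != 0 & ovoid_vec p *m GLval A = c *: ovoid_vec (act p A).
Proof.
case/SuzukiP=> _ /(_ p)[c [r [c0 e]]]; exists c => //.
by rewrite (act_eq c0 e).
Qed.

Lemma act1 p : act p 1%g = p.
Proof. by apply: (@act_eq _ _ 1); rewrite ?oner_neq0 // scale1r GLval_one mulmx1. Qed.

Lemma actM p A B : A \in G -> B \in G -> act p (A * B)%g = act (act p A) B.
Proof.
move=> /(act_vec p)[c c0 e] /(act_vec (act p A))[d d0 e'].
by apply: (@act_eq _ _ (c * d)); rewrite ?mulf_neq0 // GLval_mul mulmxA e -scalemxAl e' scalerA.
Qed.

Lemma actK A : A \in G -> cancel (act^~ A) (act^~ A^-1%g).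
Proof. by move=> GA p; rewrite -actM ?mulgV ?act1 //; apply: SuzukiV. Qed.

Lemma act_inj A : A \in G -> injective (act^~ A).
Proof. by move/actK; apply: can_inj. Qed.

(** Lets fixed points be carried to infinity and the origin by conjugation. *)
Lemma act_conj p A B : A \in G -> B \in G ->
  (act (act p B) (A ^ B)%g == act p B) = (act p A == p).
Proof.
move=> GA GB; rewrite -(actM _ GB (SuzukiJ GA GB)) -conjgC (actM _ GA GB).
by rewrite (inj_eq (act_inj GB)).
Qed.

(** * Explicit elements and double transitivity *)

Lemma Suzuki_ex (M : 'M[F]_4) (f : point -> point) : \det M = 1 ->
  (forall p, exists2 c, c != 0 & ovoid_vec p *m M = c *: ovoid_vec (f p)) ->
  exists2 A, A \in G & GLval A = M /\ act^~ A =1 f.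
Proof.
move=> dM oM; have Mu : M \is a GRing.unit by rewrite unitmxE dM unitr1.
exists (FinRing.Unit Mu).
  by apply/SuzukiP; split=> // p; have [c c0 e] := oM p; exists c, (f p).
by split=> // p; have [c c0 e] := oM p; apply: act_eq c0 _.
Qed.

(** Fixes infinity and sends the affine point (x, y) to (x + a, y + b + x sigma(a)); in particular
    it takes the origin to (a, b). *)
Definition trans_mx a b : 'M[F]_4 :=
  mx4 (row4 1 a b (tits a b)) (row4 0 1 (sigma a) (b + a * sigma a)) (row4 0 0 1 a) (row4 0 0 0 1).

Lemma det_trans_mx a b : \det (trans_mx a b) = 1.
Proof.
rewrite -det_tr det_trig /trans_mx /mx4; last first.
  apply/is_trig_mxP=> i j; rewrite !mxE.
  by case: i => [[|[|[|[|i]]]] ilt] //; case: j => [[|[|[|[|j]]]] jlt] //; rewrite /= mxE.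
by rewrite !big_ord_recl big_ord0 !mxE /= ?mxE /= !mulr1.
Qed.

Lemma trans_mx_row a b x y z d : row4 d x y z *m trans_mx a b =
  row4 d (d * a + x) (d * b + x * sigma a + y) 
    (d * tits a b + x * (b + a * sigma a) + y * a + z).
Proof.
rewrite row4_mx4 !row4Z !row4D; congr row4; ring.
Qed.

Lemma trans_mx_tits a b x y :
  row4 1 x y (tits x y) *m trans_mx a b =
  ovoid_vec (Some (x + a, y + b + x * sigma a)).
Proof.
rewrite trans_mx_row /=; congr row4; try ring.
rewrite /tits !(sigmaD, sigmaM, sigma_sigma).
(* The two sides differ by a sum z + z, which vanishes in characteristic two. *)
have -> : (x + a) * (y + b + x * sigma a) + (sigma x + sigma a) * (x + a) ^+ 2
    + (sigma y + sigma b + sigma x * a ^+ 2)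
  = 1 * (a * b + sigma a * a ^+ 2 + sigma b) + x * (b + a * sigma a) + y * a
    + (x * y + sigma x * x ^+ 2 + sigma y)
    + ((x ^+ 2 * sigma a + sigma x * x * a + sigma x * a ^+ 2 + sigma a * x * a)
     + (x ^+ 2 * sigma a + sigma x * x * a + sigma x * a ^+ 2 + sigma a * x * a)) by ring.
by rewrite addxx addr0.
Qed.

Lemma Suzuki_trans a b : exists2 A, A \in G & [/\ GLval A = trans_mx a b, act None A = None &
  forall x y, act (Some (x, y)) A = Some (x + a, y + b + x * sigma a)].
Proof.
pose f (p : point) := if p is Some (x, y) then Some (x + a, y + b + x * sigma a) else None.
have [p|A GA [AE fA]] := @Suzuki_ex (trans_mx a b) f (det_trans_mx a b).
  exists 1; rewrite ?oner_neq0 // scale1r; case: p => [[x y]|] /=.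
    by rewrite trans_mx_tits.
  by rewrite trans_mx_row; congr row4; ring.
by exists A => //; split=> // [|x y]; rewrite fA.
Qed.

Definition swap_mx : 'M[F]_4 :=
  mx4 (row4 0 0 0 1) (row4 0 0 1 0) (row4 0 1 0 0) (row4 1 0 0 0).

Lemma swap_mx_row a b c d : row4 a b c d *m swap_mx = row4 d c b a.
Proof. by rewrite row4_mx4 !row4Z !row4D; congr row4; ring. Qed.

(** The swap squares to the identity, and 1 is the only square root of 1 in characteristic two. *)
Lemma det_swap_mx : \det swap_mx = 1.
Proof.
apply: sqr_eq1; rewrite -[RHS](det1 F 4) expr2 -det_mulmx; congr (\det _).
by apply: mx4_eq; rewrite mulmxA !swap_mx_row mulmx1.
Qed.

(** This is [tits (y / z) (x / z)] = 1 / z with denominators cleared: it keeps swapped points on the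
    ovoid. *)
Lemma tits_swap x y (z := tits x y) :
  x * y * sigma z + y ^+ 2 * sigma y + sigma x * z ^+ 2 = z * sigma z.
Proof.
rewrite /z /tits !(sigmaD, sigmaM, sigmaX, sigma_sigma).
set u := sigma x; set v := sigma y.
transitivity ((x * y + u * x ^+ 2 + v) * (u * v + x ^+ 2 * u ^+ 2 + y ^+ 2)
  + ((u ^+ 2 * x ^+ 3 * y + x * y * u * v) + (u ^+ 2 * x ^+ 3 * y + x * y * u * v))).
  ring.
by rewrite addxx addr0.
Qed.

Lemma tits_eq0 x y : tits x y = 0 -> x = 0 /\ y = 0.
Proof.
move=> z0; have /= := tits_swap x y; rewrite z0 sigma0 expr0n !mulr0 add0r addr0 => /eqP.
rewrite mulf_eq0 sigma_eq0 expf_eq0 /= orbb => /eqP y0.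
move: z0; rewrite y0 /tits mulr0 sigma0 add0r addr0 => /eqP.
by rewrite mulf_eq0 sigma_eq0 expf_eq0 /= orbb => /eqP.
Qed.

Lemma Suzuki_swap : exists2 A, A \in G & act (Some (0, 0)) A = None /\ act None A = Some (0, 0).
Proof.
(* Reversing (1, x, y, z) gives (z, y, x, 1), normalised by dividing by z; z vanishes only at the
   origin. *)
pose f (p : point) := if p is Some (x, y) then
  if tits x y == 0 then None else Some (y / tits x y, x / tits x y) else Some (0, 0).
have tits0 : tits 0 0 = 0 by rewrite /tits mulr0 sigma0 mul0r !addr0.
have [p|A GA [AE fA]] := @Suzuki_ex swap_mx f det_swap_mx; last first.
  by exists A => //; rewrite !fA /= tits0 eqxx.
case: p => [[x y]|] /=; last by exists 1; rewrite ?oner_neq0 // scale1r swap_mx_row /= tits0.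
case: eqP => [z0|/eqP z0].
  have [-> ->] := tits_eq0 z0; exists 1; rewrite ?oner_neq0 // scale1r swap_mx_row /=.
  by rewrite tits0.
exists (tits x y) => //; rewrite swap_mx_row /= row4Z.
have sz0 : sigma (tits x y) != 0 by rewrite sigma_eq0.
congr row4; [by rewrite mulr1 | by rewrite mulrC divfK | by rewrite mulrC divfK |].
have /= := tits_swap x y; set z := tits x y in z0 sz0 * => e.
rewrite /tits !(sigmaM, sigmaV).
apply: (mulfI sz0); apply: (mulfI z0).
rewrite mulr1 -e; field; exact/andP.
Qed.

Lemma Suzuki_to_infty p : exists2 A, A \in G & act p A = None.
Proof.
case: p => [[x y]|]; last by exists 1%g; [exact: Suzuki1 | exact: act1].
have [T GT [_ _ fT]] := Suzuki_trans x y; have [w Gw [fw _]] := Suzuki_swap.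
have GV := SuzukiV GT; exists (T^-1 * w)%g; first exact: SuzukiM.
rewrite (actM _ GV Gw) -fw; congr act.
by rewrite -(actK GT (Some (0, 0))) fT mul0r !add0r addr0.
Qed.

(** After p is moved to infinity, a translation fixing infinity brings the image of r to the
    origin. *)
Lemma Suzuki_2trans p r : p != r ->
  exists2 A, A \in G & act p A = None /\ act r A = Some (0, 0).
Proof.
have [A GA pA] := Suzuki_to_infty p => prn.
have := inj_eq (act_inj GA) r p; rewrite pA eq_sym [RHS]eq_sym (negPf prn).
case rA: (act r A) => [[x y]|] // _.
have [T GT [_ fT0 fT]] := Suzuki_trans x y.
have GV := SuzukiV GT; exists (A * T^-1)%g; first exact: SuzukiM.
rewrite !(actM _ GA GV) pA rA; split.
  by rewrite -{1}fT0 actK.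
by rewrite -(actK GT (Some (0, 0))) fT mul0r !add0r addr0.
Qed.

(** * The stabiliser of infinity and the origin *)

Lemma sigma_monomials_free c1 c2 c3 c4 :
  (forall x, c1 * x + c2 * x ^+ 2 + c3 * sigma x + c4 * (sigma x * x ^+ 2) = 0) ->
  [/\ c1 = 0, c2 = 0, c3 = 0 & c4 = 0].
Proof.
(* Here s = 2^(n+1). As n is positive, s >= 4 keeps the exponents 1, 2, s, s + 2 distinct, and q >=
   2s puts them all below q. *)
move=> c0; have [s [sE s4 sF]] : exists s, [/\ forall x, sigma x = x ^+ s,
    (4 <= s)%N & (s + 3 <= #|F|)%N].
  exists (2 ^ n.+1)%N; split=> //; first by rewrite (@leq_exp2l 2 2).
  have -> : #|F| = (2 ^ n.+1 * 2 ^ n)%N by rewrite cardF -expnD; congr (2 ^ _)%N; lia.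
  have : (2 <= 2 ^ n)%N by rewrite (@leq_exp2l 2 1).
  by rewrite expnS; move: (2 ^ n)%N => m; clear; nia.
pose p : {poly F} := c1 *: 'X + c2 *: 'X^2 + c3 *: 'X^s + c4 *: 'X^(s + 2).
have /polyP p0 : p = 0.
  apply: vanishing_poly_eq0 => [|x]; last first.
    by rewrite !hornerE /= -[RHS](c0 x) sE exprD !expr2 !mulrA.
  apply/leq_sizeP => j jF; have {}jF := leq_trans sF jF.
  rewrite !coefE !gtn_eqF /= ?mulr0 ?addr0 //; clear -jF s4; lia.
clear -p0 s4; split; [have := p0 1%N | have := p0 2%N | have := p0 s | have := p0 (s + 2)%N];
  rewrite !coefE; do !(case: eqP => ? /=; try lia); rewrite ?(mulr0, mulr1, addr0, add0r) //; lia.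
Qed.

Lemma tits00 : tits 0 0 = 0.
Proof. by rewrite /tits mulr0 sigma0 mul0r !addr0. Qed.

(** The first and last basis vectors span fixed lines, and affine points stay affine. The ovoid
    equation for images, compared coefficient by coefficient, then forces A to be diagonal and
    relates its entries. *)
Lemma Suzuki_stab2 (A : GL4) : A \in G -> act None A = None -> act (Some (0, 0)) A = Some (0, 0) ->
  exists a k s, [/\ a != 0, k * s = sigma s, k * s = sigma k * k ^+ 2 &
    forall x y z t, row4 x y z t *m GLval A = a *: row4 x (k * y) (s * z) (k * s * t)].
Proof.
move=> GA fN f0; have [d d0] := act_vec None GA; rewrite fN /= => e4.
have [a a0] := act_vec (Some (0, 0)) GA; rewrite f0 /= tits00 => e1.
have scaled v : exists r1 r2 r3 r4, v *m GLval A = a *: row4 r1 r2 r3 r4.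
  have [r1 [r2 [r3 [r4 e]]]] := row4_eta (a^-1 *: (v *m GLval A)).
  by exists r1, r2, r3, r4; rewrite -e scalerA mulfV ?scale1r.
have [r1 [r2 [r3 [r4 e2]]]] := scaled (row4 0 1 0 0).
have [s1 [s2 [s3 [s4 e3]]]] := scaled (row4 0 0 1 0).
pose d' := d / a; have dE : d = a * d' by rewrite mulrC divfK.
have AE x y z t : row4 x y z t *m GLval A = a *: row4 (x + y * r1 + z * s1)
    (y * r2 + z * s2) (y * r3 + z * s3) (y * r4 + z * s4 + t * d').
  rewrite row4_basis !mulmxDl -!scalemxAl e1 e2 e3 e4 !row4Z !row4D.
  by congr row4; rewrite ?dE; ring.
(* A zero first coordinate would send an affine point to infinity, which is already the image of
   infinity. *)
have first_neq0 x y : 1 + x * r1 + y * s1 != 0.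
  apply/eqP=> u0; have [c c0 /esym] := act_vec (Some (x, y)) GA; rewrite [X in _ = X]AE u0.
  case e: (act _ A) => [[x' y']|].
    by rewrite /= !row4Z => /row4P[/eqP]; rewrite mulr0 mulr1 (negPf c0).
  by move: e; rewrite -fN => /(act_inj GA).
have r10 : r1 = 0.
  apply: contraTeq (first_neq0 (- r1^-1) 0) => r1n.
  by rewrite mulNr mulVf // mul0r addr0 subrr eqxx.
have s10 : s1 = 0.
  apply: contraTeq (first_neq0 0 (- s1^-1)) => s1n.
  by rewrite mulNr mulVf // mul0r addr0 subrr eqxx.
(* After division by [a] the image has first coordinate 1, so its last coordinate is [tits] of the
   middle two. *)
have titsE x y : tits (x * r2 + y * s2) (x * r3 + y * s3) = x * r4 + y * s4 + tits x y * d'.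
  have [c c0] := act_vec (Some (x, y)) GA; rewrite [X in X = _]AE.
  rewrite r10 s10 !mulr0 !addr0; case: act => [[x' y']|] /=; rewrite !row4Z.
    case/row4P; rewrite !mulr1 => ->.
    by do 2!move=> /(mulfI c0) ->; move/(mulfI c0) => ->.
  by case/row4P=> /eqP; rewrite mulr0 mulr1 (negPf a0).
(* Restricting [titsE] to y = 0, and next to x = 0, leaves a relation between the four independent
   monomials. *)
have [/eqP r40 _ /eqP r30 /eqP cE] : [/\ - r4 = 0, r2 * r3 = 0, sigma r3 = 0 &
    sigma r2 * r2 ^+ 2 - d' = 0].
  apply: sigma_monomials_free => x; have := titsE x 0.
  rewrite !mul0r !addr0 /tits sigma0 mulr0 add0r addr0 !sigmaM => /eqP; rewrite -subr_eq0.
  by move/eqP <-; ring.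
have [/eqP s40 _ /eqP s3E /eqP s20] : [/\ - s4 = 0, s2 * s3 = 0, sigma s3 - d' = 0 &
    sigma s2 * s2 ^+ 2 = 0].
  apply: sigma_monomials_free => y; have := titsE 0 y.
  rewrite !mul0r !add0r /tits sigma0 mul0r add0r !sigmaM => /eqP; rewrite -subr_eq0.
  by move/eqP <-; rewrite mul0r; ring.
move: r40 r30 cE s40 s3E s20; rewrite !oppr_eq0 !subr_eq0 sigma_eq0 mulf_eq0 sigma_eq0 expf_eq0 /= orbb.
move=> /eqP r40 /eqP r30 /eqP cE /eqP s40 /eqP s3E /eqP s20.
(* The mixed term x * y is invisible on the axes; the point (1, 1) isolates its coefficient. *)
have d'E : r2 * s3 = d'.
  have := titsE 1 1; rewrite r30 r40 s20 s40 !mul1r !add0r !addr0 /tits cE s3E sigma1 expr1n !mulr1.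
  by rewrite -!addrA !addxx !addr0 mul1r.
exists a, r2, s3; rewrite d'E s3E cE; split=> // x y z t.
rewrite AE r10 s10 r30 s20 r40 s40; congr (_ *: _); congr row4; ring.
Qed.

(** * Fixed points of elements, and commuting involutions *)

Lemma GLval_inj (A B : GL4) : GLval A = GLval B -> A = B.
Proof. exact: val_inj. Qed.

(** With p and q at infinity and the origin, a nonzero coordinate of the third point forces k = 1 or
    s = 1, and the relations between k and s give the other. The matrix is then a scalar a with a^4
    = 1, hence a = 1. *)
Lemma Suzuki_fix3 A p q r : A \in G -> p != q -> r != p -> r != q ->
  act p A = p -> act q A = q -> act r A = r -> A = 1%g.
Proof.
move=> GA pq rp rq /eqP fp /eqP fq /eqP fr; have [B GB [pB qB]] := Suzuki_2trans pq.
have GAB := SuzukiJ GA GB; apply/eqP; rewrite -(conjg_eq1 A B); apply/eqP.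
move: fp fq fr; rewrite -!(act_conj _ GA GB) pB qB => /eqP fp /eqP fq.
have := inj_eq (act_inj GB) r p; have := inj_eq (act_inj GB) r q; rewrite pB qB (negPf rp) (negPf rq).
case: (act r B) => [[x y]|] // xy0 _ /eqP fr.
have [a [k [s [a0 ksE ksE' AE]]]] := Suzuki_stab2 GAB fp fq.
have [c c0] := act_vec (Some (x, y)) GAB; rewrite fr [X in X = _]AE !row4Z.
case/row4P; rewrite !mulr1 => -> /(mulfI c0) kx /(mulfI c0) sy _.
have [k1 s1] : k = 1 /\ s = 1.
  have fix_eq1 (u v : F) : u != 0 -> v * u = u -> v = 1.
    by move=> u0 e; apply: (mulIf u0); rewrite mul1r.
  have [x0|x0] := eqVneq x 0; last first.
    have k1 := fix_eq1 _ _ x0 kx; split=> //.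
    by move: ksE'; rewrite k1 sigma1 expr1n !mul1r.
  have [y0|y0] := eqVneq y 0; first by rewrite x0 y0 eqxx in xy0.
  have s1 := fix_eq1 _ _ y0 sy; split=> //.
  by move: ksE; rewrite s1 sigma1 mulr1.
have AM : GLval (A ^ B)%g = a%:M.
  by apply: mx4_eq; rewrite [LHS]AE mul_mx_scalar k1 s1 !row4Z; congr row4; ring.
apply: GLval_inj; rewrite AM; congr _%:M.
case/SuzukiP: GAB => + _; rewrite AM det_scalar (exprM a 2 2) => /sqr_eq1/sqr_eq1 //.
Qed.

(** Two fixed points make a conjugate of A diagonal; its entries square to 1, so they equal 1. *)
Lemma involution_fix_unique A p q : A \in G -> (A * A = 1)%g -> A != 1%g ->
  act p A = p -> act q A = q -> p = q.
Proof.
move=> GA AA A1 /eqP fp /eqP fq; apply: contraNeq A1 => pq.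
have [B GB [pB qB]] := Suzuki_2trans pq; have GAB := SuzukiJ GA GB.
rewrite -(conjg_eq1 A B); apply/eqP.
move: fp fq; rewrite -!(act_conj _ GA GB) pB qB => /eqP fp /eqP fq.
have [a [k [s [a0 ksE ksE' AE]]]] := Suzuki_stab2 GAB fp fq.
have /(congr1 (@GLval _ _)) : ((A ^ B) * (A ^ B) = 1)%g by rewrite -conjMg AA conj1g.
rewrite GLval_mul GLval_one => sq.
have sqE (v : 'rV[F]_4) : v *m GLval (A ^ B)%g *m GLval (A ^ B)%g = v by rewrite -mulmxA sq mulmx1.
have := sqE (row4 1 1 1 1); rewrite AE row4Z AE row4Z => /row4P[].
rewrite !mulr1 => /sqr_eq1 a1; rewrite a1 !mul1r => /sqr_eq1 k1 /sqr_eq1 s1 _.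
apply: GLval_inj; rewrite GLval_one; apply: mx4_eq;
  by rewrite mulmx1 AE a1 k1 s1 scale1r; congr row4; ring.
Qed.

Lemma involution_fix_exists A : A \in G -> (A * A = 1)%g -> exists p, act p A = p.
Proof.
move=> GA AA; pose s := perm (act_inj GA).
have ss : (s ^+ 2 = 1)%g.
  by apply/permP=> p; rewrite expgS expg1 permM !permE -actM // AA act1.
have s2 : (2.-group <[s]>)%g.
  by rewrite /pgroup -orderE (@pnat_dvd _ 2) // order_dvdn ss.
have acts_s : [acts <[s]>, on setT | 'P]%g.
  by apply/actsP=> u _ p; rewrite !inE.
case: (pickP (fun p => act p A == p)) => [p /eqP|nofix]; first by exists p.
(* The number of fixed points is congruent modulo 2 to the number of points, q^2 + 1, which is
   odd. *)
have := pgroup_fix_mod s2 acts_s.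
rewrite (_ : 'Fix_(_ | _)(_)%g = set0); last first.
  apply/setP=> p; rewrite in_setI in_set0; apply/negP=> /andP[_ /afixP/(_ s (cycle_id s))].
  by move/eqP; rewrite /= apermE permE nofix.
rewrite cards0 cardsT card_option card_prod cardF mod0n modn2 /=.
by rewrite expnS -mulnA oddM.
Qed.

(** Dividing A by the translation taking the origin to its image (a, b) leaves a diagonal matrix.
    The condition A^2 = 1 makes that matrix trivial and gives a sigma(a) = 0. *)
Lemma involution_at_infinity A : A \in G -> (A * A = 1)%g -> act None A = None ->
  exists b, GLval A = trans_mx 0 b.
Proof.
move=> GA AA fN; case f0: (act (Some (0, 0)) A) => [[a b]|]; last first.
  by move: f0; rewrite -fN => /(act_inj GA).
have [T GT [TM TN fT]] := Suzuki_trans a b; have GV := SuzukiV GT.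
have AV p : act p (A * T^-1)%g = act (act p A) T^-1%g by rewrite (actM _ GA GV).
have [||c [k [s [c0 ksE ksE' DE]]]] := Suzuki_stab2 (SuzukiM GA GV).
- by rewrite AV fN -{1}TN actK.
- by rewrite AV f0 -[RHS](actK GT) fT mul0r !add0r addr0.
have AE x y z t : row4 x y z t *m GLval A =
    c *: (row4 x (k * y) (s * z) (k * s * t) *m trans_mx a b).
  by rewrite -[A](mulgKV T) GLval_mul mulmxA DE -scalemxAl TM.
have /(congr1 (@GLval _ _)) := AA; rewrite GLval_mul GLval_one => sq.
have sqE (v : 'rV[F]_4) : v *m GLval A *m GLval A = v by rewrite -mulmxA sq mulmx1.
have := sqE (row4 0 1 0 0); rewrite AE trans_mx_row row4Z AE trans_mx_row row4Z => /row4P[_ kE _ _].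
have := sqE (row4 1 0 0 0); rewrite AE trans_mx_row row4Z AE trans_mx_row row4Z.
rewrite !(mulr0, mul0r, addr0, add0r, mulr1) => /row4P[/sqr_eq1 c1].
move: kE; rewrite !(mulr0, mul0r, addr0, add0r, mulr1) c1 !mul1r => /sqr_eq1 k1.
have s1 : s = 1 by move: ksE'; rewrite k1 sigma1 expr1n !mul1r.
move=> _; rewrite k1 s1 !mul1r addrAC addxx add0r => /eqP.
rewrite mulf_eq0 sigma_eq0 orbb => /eqP a0 _.
exists b; apply: mx4_eq; by rewrite AE k1 s1 c1 a0 scale1r; congr (row4 _ _ _ _ *m _); ring.
Qed.

(** With p moved to infinity both become translations with a = 0, and these commute. *)
Lemma involutions_commute A B p : A \in G -> B \in G -> (A * A = 1)%g -> (B * B = 1)%g ->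
  act p A = p -> act p B = p -> (A * B = B * A)%g.
Proof.
move=> GA GB AA BB /eqP fA /eqP fB; have [C GC pC] := Suzuki_to_infty p.
move: fA fB; rewrite -(act_conj _ GA GC) -(act_conj _ GB GC) pC => /eqP fA /eqP fB.
apply: (@conjg_inj _ C); rewrite !conjMg.
have [|a AE] := involution_at_infinity (SuzukiJ GA GC) _ fA; first by rewrite -conjMg AA conj1g.
have [|b BE] := involution_at_infinity (SuzukiJ GB GC) _ fB; first by rewrite -conjMg BB conj1g.
apply: GLval_inj; rewrite [LHS]GLval_mul [RHS]GLval_mul AE BE; apply: mx4_eq;
  by rewrite !mulmxA !trans_mx_row /tits sigma0; congr row4; ring.
Qed.

(** The image of p under a is again fixed by c, whose fixed point is unique. *)
Lemma commuting_involutions_fix a c p : a \in G -> c \in G -> (c * c = 1)%g -> c != 1%g ->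
  commute c a -> act p c = p -> act p a = p.
Proof.
move=> Ga Gc cc c1 ca fc; apply/esym; apply: (involution_fix_unique Gc cc c1 fc).
by rewrite -(actM _ Ga Gc) -ca (actM _ Gc Ga) fc.
Qed.

(* If [a] and [b] swap the fixed point [p] of [c] with [r], then [a * b] fixes the
   three points [p], [r] and [act r c]. *)
Lemma involutions_common_fix a b c : a \in G -> b \in G -> c \in G ->
  (a * a = 1)%g -> (b * b = 1)%g -> (c * c = 1)%g -> c != 1%g -> a != b ->
  commute c (a * b) -> exists p, [/\ act p a = p, act p b = p & act p c = p].
Proof.
move=> Ga Gb Gc aa bb cc c1 ab cab; have [p fc] := involution_fix_exists Gc cc.
have Gab := SuzukiM Ga Gb; have fab := commuting_involutions_fix Gab Gc cc c1 cab fc.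
pose r := act p a; have ra : act r a = p by rewrite -(actM _ Ga Ga) aa act1.
have rb : act r b = p by rewrite -(actM _ Ga Gb).
have pb : act p b = r by rewrite -rb -(actM _ Gb Gb) bb act1.
have [rp|rp] := eqVneq r p; first by exists p; split=> //; rewrite -{2}rp.
have fabr : act r (a * b)%g = r by rewrite (actM _ Ga Gb) ra.
have fabq : act (act r c) (a * b)%g = act r c.
  by rewrite -(actM _ Gc Gab) cab (actM _ Gab Gc) fabr.
case/eqP: ab; have ab1 : (a * b = 1)%g.
  apply: (Suzuki_fix3 Gab _ _ _ fab fabr fabq); first by rewrite eq_sym.
    by rewrite -[X in _ != X]fc (inj_eq (act_inj Gc)).
  apply: contra_neq rp => fcr; exact: (involution_fix_unique Gc cc c1 fcr fc).
by rewrite -[a]mulg1 -bb mulgA ab1 mul1g.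
Qed.

(** * The Killing form of the class of involutions *)

Lemma Suzuki_killing t : t \in G -> #[t]%g = 2%N ->
  (forall a b, killing_adj G (t ^: G)%g a b = commuting_adj (t ^: G)%g a b) /\
  killing_reducible G (t ^: G)%g /\ killing_nondegenerate G (t ^: G)%g.
Proof.
move=> Gt t2; set C := (t ^: G)%g.
have tt : (t * t = 1)%g by have := expg_order t; rewrite t2.
have t1 : t != 1%g by apply/eqP=> t1; rewrite t1 order1 in t2.
have CP c : c \in C -> [/\ c \in G, (c * c = 1)%g & c != 1%g].
  by case/imsetP=> x Gx ->; rewrite SuzukiJ // -conjMg tt conj1g conjg_eq1.
have sCG : C \subset G by apply/subsetP=> c /CP[].
have C_inv a : a \in C -> (a * a = 1)%g by case/CP.
have CJ a x : a \in C -> x \in G -> (a ^ x)%g \in C.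
  by case/imsetP=> y Gy -> Gx; rewrite -conjgM; apply/imset_f/SuzukiM.
(* Conjugating a by an element that moves p moves its unique fixed point away from p. *)
have C_move a p : a \in C -> act p a = p -> exists2 b, b \in C & act p b != p.
  move=> aC fa; have [Ga aa a1] := CP a aC.
  have [x Gx px] : exists2 x, x \in G & act p x != p.
    case: p {fa} => [q|]; first by have [x Gx fx] := Suzuki_to_infty (Some q); exists x; rewrite ?fx.
    by have [x Gx [_ fx]] := Suzuki_swap; exists x; rewrite ?fx.
  exists (a ^ x)%g; first exact: CJ.
  apply: contra_neq px => fax; have [GJ JJ J1] := CP _ (CJ _ _ aC Gx).
  apply: (involution_fix_unique GJ JJ J1 _ fax).
  by apply/eqP; rewrite (act_conj _ Ga Gx) fa.
have C_cent a b c : a \in C -> b \in C -> c \in C -> a != b -> commute c (a * b)%g ->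
    [/\ commute a b, commute c a & commute c b].
  move=> /CP[Ga aa _] /CP[Gb bb _] /CP[Gc cc c1] ab cab.
  have [p [fa fb fc]] := involutions_common_fix Ga Gb Gc aa bb cc c1 ab cab.
  by split; apply: (involutions_commute (p := p)).
have adjE := killing_adj_commuting sCG C_cent.
split; first exact: adjE.
split; last first.
  apply: (killing_nondegenerate_involutions sCG C_inv C_cent) => a aC.
  have [Ga aa a1] := CP a aC; have [p fa] := involution_fix_exists Ga aa.
  have [b bC pb] := C_move a p aC fa; exists b => // ba; have [Gb _ _] := CP b bC.
  by case/eqP: pb; apply: (commuting_involutions_fix Gb Ga aa a1 _ fa).
have [p fp] := involution_fix_exists Gt tt.
have tC : t \in C by rewrite -[t]conjg1; apply/imset_f/Suzuki1.
have [b bC pb] := C_move t p tC fp => /(_ t b tC bC) tb.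
(* Neighbours share their fixed point, so no path leads from t, fixing p, to b, moving p. *)
have clo : closed (killing_adj G C) [pred c | act p c == p].
  move=> x y; rewrite adjE => /and4P[/CP[Gx xx x1] /CP[Gy yy y1] _ /eqP xy].
  rewrite !inE; apply/eqP/eqP=> [fx|fy].
    by apply: (commuting_involutions_fix Gy Gx xx x1 xy fx).
  exact: (commuting_involutions_fix Gx Gy yy y1 (esym xy) fy).
by have := closed_connect clo tb; rewrite !inE fp eqxx (negPf pb).
Qed.

End TitsOvoid.

Theorem theorem5p2 (F : finFieldType) (n : nat) :
  (0 < n)%N -> #|F| = (2 ^ (2 * n).+1)%N ->
  forall t : {'GL_4[F]}, t \in Suzuki F n -> #[t]%g = 2%N ->
  let G := Suzuki F n in
  let C := (t ^: G)%g in
  (forall a b, killing_adj G C a b = commuting_adj C a b) /\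
  killing_reducible G C /\ killing_nondegenerate G C.
Proof.
move=> n_gt0 cardF t Gt t2; exact: (Suzuki_killing n_gt0 cardF Gt t2).
Qed.
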